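(* If $D$ is a diagram that contains no ghost cells, then $\widehat{\mathrm{MaxG}}(D)=\widehat{\mathrm{sf}}(D)$.
   Context: A diagram is a finite set of cells at positions $(r,c)$ with $r,c$ positive integers ($r$ = row from the bottom, $c$ = column), at most one cell per position; each cell is either ordinary, written $(r,c)$, or a ghost cell, written $\langle r,c\rangle$. A position is empty if it contains no cell. Ghost move at row $r$ of $D$: let the rightmost cell of row $r$ (ghost or not) lie in column $c$. The move does nothing if that cell is a ghost cell, or every position $(r',c)$ with $r'<r$ is occupied, or, letting $\hat r<r$ be maximal with $(\hat r,c)$ empty, some $(r^*,c)$ with $\hat r<r^*<r$ holds a ghost cell. Otherwise it moves the cell from $(r,c)$ to $(\hat r,c)$ and places a ghost cell $\langle r,c\rangle$ at $(r,c)$. $GKD(D)$ is the set of $D$ and all diagrams obtained from $D$ by finite sequences of ghost moves; $\widehat{\mathrm{MaxG}}(D)$ is the maximum number of ghost cells in a diagram of $GKD(D)$. Construction of $\widehat{\mathsf{snow}}(D)$ for $D$ without ghost cells: let the nonempty columns be $c_1<\dots<c_m$, $R_i=\{r:(r,c_i)\in D\}$ and $F_i=\{r\in R_i: r\in\bigcup_{j=i+1}^m R_j\}$ (rows in which the cell in column $c_i$ is not rightmost). Label cells: every cell of column $c_m$ gets label $1$. For $i\in[m-1]$: each cell $(r,c_i)$ with $r\in F_i$ gets label $r$; then, processing $r\in R_i\setminus F_i$ in decreasing order, the cell $(r,c_i)$ gets as label the maximal $r^*\in\bigcup_{j=i+1}^m R_j$ with $r^*<r$ that is not already the label of a cell of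 column $c_i$, or label $1$ if no such $r^*$ exists. Then an empty position $(r,c)$ lying strictly below some cell of $D$ in column $c$ receives a snowflake iff there is a cell $(\tilde r,c)\in D$ with $\tilde r>r$ whose label is $\le r$. $\widehat{\mathrm{sf}}(D)$ is the number of snowflakes. *)

(* Defs.v *)
From mathcomp Require Import all_boot finmap.
From mathcomp Require Import boolp.

Set Implicit Arguments.
Unset Strict Implicit.
Unset Printing Implicit Defensive.

Local Open Scope fset_scope.
Local Open Scope fmap_scope.
Local Open Scope nat_scope.

(* [D.[? (r, c)]] is [None] if the position (r, c) is empty, [Some false] if it
   holds an ordinary cell and [Some true] if it holds a ghost cell. *)
Definition cell_map := {fmap nat * nat -> bool}.

Definition is_diagram (D : cell_map) : Prop :=
  forall r c, (r, c) \in domf D -> 0 < r /\ 0 < c.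

Definition is_ghost (D : cell_map) (p : nat * nat) : bool :=
  D.[? p] == Some true.

Definition ghost_free (D : cell_map) : Prop :=
  forall p, p \in domf D -> ~~ is_ghost D p.

Definition num_ghosts (D : cell_map) : nat :=
  #|` [fset p in domf D | is_ghost D p]|.

(* Since rows and columns of a diagram are positive, the value 0 below stands
   for "row r has no cell", resp. "every (r', c) with r' < r is occupied". *)
Definition rightmost (D : cell_map) (r : nat) : nat :=
  \max_(p <- domf D | p.1 == r) p.2.

Definition drop_row (D : cell_map) (r c : nat) : nat :=
  \max_(1 <= r' < r | (r', c) \notin domf D) r'.

Definition ghost_move (D : cell_map) (r : nat) : cell_map :=
  let c := rightmost D r in
  let rhat := drop_row D r c in
  if [|| (r, c) \notin domf D, is_ghost D (r, c), rhat == 0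
       | has (fun s => is_ghost D (s, c)) (index_iota rhat.+1 r)]
  then D
  else D.[(rhat, c) <- false].[(r, c) <- true].

Inductive GKD (D : cell_map) : cell_map -> Prop :=
| GKD_refl : GKD D D
| GKD_move (E : cell_map) (r : nat) : GKD D E -> GKD D (ghost_move E r).

Definition GKD_ghost_count (D : cell_map) : pred nat :=
  fun n => `[< exists2 E, GKD D E & num_ghosts E = n >].

Lemma GKD_ghost_count_ex (D : cell_map) : exists n, GKD_ghost_count D n.
Proof.
by exists (num_ghosts D); apply/asboolP; exists D; first exact: GKD_refl.
Qed.

Definition box (D : cell_map) : {fset nat * nat} :=
  [fset (r, q.2) | q : nat * nat in domf D, r : nat in iota 0 q.1.+1].

Lemma drop_row_lt (D : cell_map) (r c : nat) : 0 < r -> drop_row D r c < r.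
Proof.
move=> r0; rewrite /drop_row big_seq_cond.
elim/big_ind: _ => // [x y hx hy|i]; first by rewrite gtn_max hx hy.
by rewrite mem_index_iota => /andP[/andP[_ ->]].
Qed.

Lemma GKD_domf_box (D E : cell_map) : GKD D E -> domf E `<=` box D.
Proof.
have boxP p : reflect (exists2 q, q \in domf D & p.2 = q.2 /\ p.1 <= q.1)
                      (p \in box D).
  apply: (iffP idP) => [/imfset2P[q qD [r hr ->]]|[q qD [e le]]].
    have : r \in iota 0 q.1.+1 by [].
    by rewrite mem_iota /= => rq; exists q => //; split.
  apply/imfset2P; exists q => //; exists p.1; last by rewrite -e; case: p {e le}.
  suff : p.1 \in iota 0 q.1.+1 by [].
  by rewrite mem_iota /=.
elim=> [|{}E r _ IH].
  by apply/fsubsetP => p pD; apply/boxP; exists p.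
rewrite /ghost_move; case: ifP => // /norP[/negPn rE /norP[_ /norP[h0 _]]].
have r0 : 0 < r.
  by case: r rE h0 => // _; rewrite /drop_row big_geq.
have /boxP[q qD [/= e le]] := fsubsetP IH _ rE.
apply/fsubsetP => p; rewrite !inE => /or3P[/eqP->|/eqP->|/(fsubsetP IH)//].
  by apply/boxP; exists q.
apply/boxP; exists q => //; split=> //=.
by apply: leq_trans le; apply/ltnW/drop_row_lt.
Qed.

Lemma GKD_ghost_count_bound (D : cell_map) (n : nat) :
  GKD_ghost_count D n -> n <= #|` box D|.
Proof.
move=> /asboolP[E DE <-]; apply: fsubset_leq_card.
apply: fsubset_trans (GKD_domf_box DE).
by apply/fsubsetP => p; rewrite !inE => /andP[].
Qed.

Definition MaxG (D : cell_map) : nat :=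
  ex_maxn (GKD_ghost_count_ex D) (@GKD_ghost_count_bound D).

Definition col_rows (D : cell_map) (c : nat) : {fset nat} :=
  [fset p.1 | p in domf D & p.2 == c].

(* For c = c_i this is the union of the R_j with j > i. *)
Definition right_rows (D : cell_map) (c : nat) : {fset nat} :=
  [fset p.1 | p in domf D & c < p.2].

(* Labels of one column are recorded as a finite map from rows to labels. *)
Definition next_label (U : {fset nat}) (L : {fmap nat -> nat}) (r : nat) : nat :=
  let cand := [fset s in U | (s < r) && (s \notin codomf L)] in
  if cand == fset0 then 1 else \max_(s <- cand) s.

(* In the last nonempty column [right_rows D c] is empty, so that the general
   rule gives every cell the label 1, as required there. *)
Definition col_labels (D : cell_map) (c : nat) : {fmap nat -> nat} :=
  let R := col_rows D c in
  let U := right_rows D c in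
  foldl (fun L r => L.[r <- next_label U L r])
        [fmap r : R `&` U => val r]
        (sort geq (R `\` U)).

Definition snow (D : cell_map) : {fset nat * nat} :=
  [fset p in [fset (r, q.2) | q : nat * nat in domf D, r : nat in index_iota 1 q.1] |
     (p \notin domf D) &&
     has (fun q => [&& q.2 == p.2, p.1 < q.1
                     & oapp (fun l => l <= p.1) false (col_labels D q.2).[? q.1]])
         (domf D)].

Definition sf (D : cell_map) : nat := #|` snow D|.

(* Main.v *)
Require Import Defs.
From mathcomp Require Import all_boot finmap.
From mathcomp Require boolp.
From mathcomp Require Import zify.

(* The ghosts of a diagram of GKD(D) are as numerous as the positions filled in
   addition to those of D.

   Fix a column, let U be the set of rows with a cell of D further right, and
   let p be an empty position of the column.  All labels above p exceed p iff
   the cells above p satisfy Hall's condition: for each y > p there are at most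
   as many cells as rows of U in (p, y].  Moves in the column preserve this
   condition, and under it no cell can drop to p, since it would have to jump
   over a full interval (p, r) with r not in U.  So only snowflake positions
   are ever filled.

   Conversely, treat the columns from left to right, and in each column always
   move the highest cell which is rightmost in its row and has an empty position
   below.  Ghosts then never block a cell that could still drop, so when the
   process stops every ordinary cell with an empty position below lies in U.  If
   p is still empty, no cell has passed it; the cells above p have only moved
   down and have ended in distinct rows of U, so D itself satisfies Hall's
   condition at p, and p carries no snowflake. *)

Set Implicit Arguments.
Unset Strict Implicit.
Unset Printing Implicit Defensive.

Local Open Scope fset_scope.
Local Open Scope fmap_scope.
Local Open Scope nat_scope.

(** * Counting in half-open intervals (p, y] *)

Definition cnt (P : pred nat) (p y : nat) : nat :=
  \sum_(p.+1 <= i < y.+1) P i.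

Lemma cntE (P : pred nat) (p y : nat) :
  cnt P p y = size [seq i <- index_iota p.+1 y.+1 | P i].
Proof.
rewrite size_filter -sum1_count /cnt [RHS]big_mkcond /=.
by apply: eq_bigr => i _; case: (P i).
Qed.

Lemma cnt_empty (P : pred nat) (p y : nat) : y <= p -> cnt P p y = 0.
Proof. by move=> yp; rewrite /cnt big_geq. Qed.

Lemma cnt_cat (P : pred nat) (p x y : nat) :
  p <= x <= y -> cnt P p y = cnt P p x + cnt P x y.
Proof. by move=> /andP[px xy]; rewrite /cnt (big_cat_nat (n := x.+1)). Qed.

Lemma leq_cnt (P Q : pred nat) (p y : nat) :
  (forall i, p < i <= y -> P i -> Q i) -> cnt P p y <= cnt Q p y.
Proof.
move=> PQ; rewrite /cnt !big_nat; apply: leq_sum => i /PQ.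
by case: (P i) => // ->.
Qed.

Lemma eq_in_cnt (P Q : pred nat) (p y : nat) :
  (forall i, p < i <= y -> P i = Q i) -> cnt P p y = cnt Q p y.
Proof. by move=> PQ; apply: eq_big_nat => i /PQ ->. Qed.

Lemma cnt_full (P : pred nat) (p y : nat) :
  (forall i, p < i <= y -> P i) -> cnt P p y = y - p.
Proof.
move=> PT; rewrite (@eq_in_cnt _ predT) => [|i /PT -> //].
by rewrite /cnt sum_nat_const_nat muln1 subSS.
Qed.

Lemma cnt_le_size (P : pred nat) (p y : nat) : cnt P p y <= y - p.
Proof. by rewrite -(@cnt_full predT) //; apply: leq_cnt. Qed.

Lemma cnt_pred1 (p y x : nat) : cnt (pred1 x) p y = (p < x <= y).
Proof.
rewrite cntE size_filter count_uniq_mem ?iota_uniq // mem_index_iota ltnS.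
by [].
Qed.

Lemma cnt_split (P Q : pred nat) (p y : nat) :
  cnt P p y = cnt (fun i => P i && Q i) p y + cnt (fun i => P i && ~~ Q i) p y.
Proof.
by rewrite /cnt -big_split; apply: eq_bigr => i _ /=; case: (P i); case: (Q i).
Qed.

(** * Hall's condition in one column and its behaviour under drops *)

(* One column of a diagram: [O] lists the rows of its ordinary cells, and the
   cell in row r drops to row h, jumping over the cells in between. *)
Definition drop_cell (O : pred nat) (r h : nat) : pred nat :=
  fun i => (i == h) || ((i != r) && O i).

(** The drop adds h and deletes r; both indicators are added rather than subtracted, since
    subtraction on [nat] is truncated. *)
Lemma cnt_drop (O : pred nat) (r h p y : nat) : h < r -> O r -> ~~ O h ->
  cnt (drop_cell O r h) p y + (p < r <= y) = cnt O p y + (p < h <= y).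
Proof.
move=> hr Or Oh; rewrite -!cnt_pred1 /cnt -!big_split.
apply: eq_bigr => i _ /=; rewrite /drop_cell.
case: (i =P h) => [->|_]; first by rewrite (negPf Oh) ltn_eqF.
by case: (i =P r) => [->|_]; rewrite /= ?Or ?addn0.
Qed.

(* Hall's condition for giving each cell above row p its own label, a row of U
   above p and not above the cell. *)
Definition hall (O U : pred nat) (p : nat) := forall y, cnt O p y <= cnt U p y.

(** All of (y, r] belongs to O, whereas U, missing r, has at most r - y - 1 elements there; the
    condition at r therefore leaves a slack of at least one at y. *)
Lemma hall_strict (O U : pred nat) (p r h y : nat) :
  hall O U p -> ~~ U r -> (forall i, h < i <= r -> O i) ->
  maxn h p <= y < r -> cnt O p y < cnt U p y.
Proof.
move=> H Ur OO /andP[]; rewrite geq_max => /andP[hy py] yr.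
have EO : cnt O p r = cnt O p y + (r - y).
  rewrite (@cnt_cat _ p y) ?py 1?ltnW //; congr (_ + _).
  by apply: cnt_full => i /andP[yi ir]; rewrite OO // ir (leq_ltn_trans hy yi).
have EU : cnt U p r = cnt U p y + cnt U y r.-1.
  rewrite (@cnt_cat _ p y) ?py 1?ltnW //; congr (_ + _).
  case: r yr Ur {OO EO} => // r yr /negPf Ur.
  by rewrite (@cnt_cat _ y r) ?leqnSn ?andbT // /cnt big_nat1 Ur addn0.
have := H r; have := cnt_le_size U y r.-1; rewrite EO EU.
by move: (cnt O p y) (cnt U p y) (cnt U y r.-1) => a b d; lia.
Qed.

(** A drop raises the count of (p, y] only when p < h <= y < r, and there [hall_strict] supplies the
    slack. *)
Lemma hall_drop (O U : pred nat) (p r h : nat) :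
  hall O U p -> ~~ O p -> ~~ O h -> ~~ U r -> h < r ->
  (forall i, h < i <= r -> O i) ->
  h != p /\ hall (drop_cell O r h) U p.
Proof.
move=> H Op Oh Ur hr OO.
have S := hall_strict H Ur OO.
have hp : h != p.
  (* For h = p, strictness at y = p would compare two counts of the empty interval. *)
  by apply/eqP => E; have := S p; rewrite E maxnn leqnn -E hr !cnt_empty // => /(_ isT).
split=> // y; have Or : O r by rewrite OO // hr /=.
have := cnt_drop p y hr Or Oh.
(* Row p is not in O, so the drop does not jump over it. *)
have pN : (p < h) || (r <= p).
  rewrite ltnNge leq_eqVlt (negPf hp) /=.
  case: (ltnP h p) => //= hp'; rewrite leqNgt; apply: contra Op => pr.
  by rewrite OO // hp' ltnW.
have := H y.
case: (boolP (maxn h p <= y < r)) => [/S|]; first by lia.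
lia.
Qed.

Lemma cnt_drop_ge (O : pred nat) (r h p y : nat) : h < r -> O r -> ~~ O h ->
  (p < h) || (r <= p) -> cnt O p y <= cnt (drop_cell O r h) p y.
Proof. by move=> hr Or Oh pN; have := cnt_drop p y hr Or Oh; lia. Qed.

(** * Greedy labelling *)

Lemma next_labelP (U : {fset nat}) (L : {fmap nat -> nat}) (r : nat) :
  let v := next_label U L r in
  (v = 1 /\ forall s, s \in U -> s < r -> s \in codomf L) \/
  [/\ v \in U, v < r, v \notin codomf L &
      forall s, s \in U -> v < s < r -> s \in codomf L].
Proof.
rewrite /next_label; set K := [fset s in U | (s < r) && (s \notin codomf L)].
have KE s : (s \in K) = [&& s \in U, s < r & s \notin codomf L].
  by rewrite /K !inE /=.
case: (K =P fset0) => [K0|/eqP/fset0Pn[k kK]] /=.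
  left; split=> // s sU sr; apply: contraT => sL.
  by have := KE s; rewrite K0 inE sU sr sL.
right; set v := \max_(s <- K) s.
have vK : v \in K.
  have : v \in K \/ v = 0.
    rewrite /v big_seq; elim/big_ind: _ => [|x y hx hy|i iK]; [by right| |by left].
    by case: (leqP x y).
  (* The default value 0 of the maximum is harmless: it forces k = 0, so that 0 is itself in [K]. *)
  case=> // v0; have := @leq_bigmax_seq _ (enum_fset K) predT id k kK isT.
  by rewrite -/v v0 leqn0 => /eqP <-.
have := vK; rewrite KE => /and3P[vU vr vL]; split=> // s sU /andP[vs sr].
apply: contraT => sL.
have /(@leq_bigmax_seq _ (enum_fset K) predT id s) : s \in K by rewrite KE sU sr sL.
by move=> /(_ isT); rewrite -/v leqNgt vs.
Qed.

Lemma mem_codomf_set (L : {fmap nat -> nat}) (r v u : nat) :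
  r \notin domf L -> (u \in codomf L.[r <- v]) = (u == v) || (u \in codomf L).
Proof.
move=> rL; apply/codomfP/orP => [[x]|[/eqP->|/codomfP[x xu]]].
- rewrite fnd_set; case: ifP => _ H; first by case: H => ->; left.
  by right; apply/codomfP; exists x.
- by exists r; rewrite fnd_set eqxx.
- exists x; rewrite fnd_set; case: eqP => // xr.
  by move: xu; rewrite xr not_fnd.
Qed.

(** The fold of [col_labels], started from an arbitrary labelling to allow induction on the list. *)
Definition add_labels (U : {fset nat}) (L : {fmap nat -> nat}) (s : seq nat) :=
  foldl (fun L r => L.[r <- next_label U L r]) L s.

Lemma add_labels_dom (U : {fset nat}) (L : {fmap nat -> nat}) (s : seq nat) r :
  (r \in domf (add_labels U L s)) = (r \in domf L) || (r \in s).
Proof.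
elim: s L => [|x s IH] L /=; first by rewrite orbF.
by rewrite [LHS]IH mem_setf !inE; case: (r == x); rewrite /= ?orbT.
Qed.

(** Label 1 is exempt because it is the default. It never exceeds a positive p, so labels above p
    are pairwise distinct rows of U. *)
Definition proper_labels (U : {fset nat}) (L : {fmap nat -> nat}) :=
  (forall r l, L.[? r] = Some l -> l = 1 \/ l \in U /\ l <= r) /\
  (forall r r' l, L.[? r] = Some l -> L.[? r'] = Some l -> r = r' \/ l = 1).

Lemma add_labels_proper (U : {fset nat}) (L : {fmap nat -> nat}) (s : seq nat) :
  uniq s -> (forall r, r \in s -> r \notin domf L) ->
  proper_labels U L -> proper_labels U (add_labels U L s).
Proof.
elim: s L => //= r s IH L /andP[rs us] sL [Lle Linj].
apply: IH => // [x xs|].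
  rewrite mem_setf !inE negb_or sL ?inE ?xs ?orbT // andbT.
  by apply: contra rs => /eqP <-.
have rL : r \notin domf L by apply: sL; rewrite inE eqxx.
have NL := next_labelP U L r; set v := next_label _ _ _ in NL *.
split=> [x l|x x' l]; rewrite !fnd_set.
  case: eqP => [-> [<-]|_]; last exact: Lle.
  by case: NL => [[-> _]|[vU vr _ _]]; [left|right; rewrite ltnW].
(* A label already in use is chosen again only as the default. *)
have fresh y : L.[? y] = Some v -> v = 1.
  move=> yv; case: NL => [[-> _] //|[_ _ /negP[]]].
  by apply/codomfP; exists y.
case: eqP => [->|_]; case: eqP => [->|_]; [by left| | |exact: Linj].
- by case=> <- /fresh; right.
- by move=> H [E]; move: H; rewrite -E => /fresh; right.
Qed.

Lemma add_labels_hall (U : {fset nat}) (L : {fmap nat -> nat}) (s : seq nat) p :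
  0 < p -> sorted gtn s ->
  (forall r, r \in s -> r \notin U /\ r \notin domf L) ->
  (forall y, cnt (mem s) p y <= cnt (fun u => (u \in U) && (u \notin codomf L)) p y) ->
  (forall r l, L.[? r] = Some l -> p < r -> p < l) ->
  forall r l, (add_labels U L s).[? r] = Some l -> p < r -> p < l.
Proof.
move=> p0; elim: s L => [|r s IH] L /= srt sUL H Lp; first exact: Lp.
have [rU rL] := sUL r (mem_head _ _).
have lt_r x : x \in s -> x < r by move: x; apply/allP/(order_path_min _ srt) => ? ? ? /=; lia.
have rs : r \notin s by apply/negP => /lt_r; rewrite ltnn.
have NL := next_labelP U L r.
have consE q y : cnt (mem (r :: s)) q y = (q < r <= y) + cnt (mem s) q y.
  rewrite -cnt_pred1 /cnt -big_split; apply: eq_bigr => i _ /=.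
  by rewrite inE; case: (i =P r) => // ->; rewrite (negPf rs).
set v := next_label _ _ _ in NL *.
set P := (fun u => _) in H.
have Prv : cnt P (maxn v p) r = 0.
  rewrite /cnt big_nat big1 // => i; rewrite gtn_max => /andP[/andP[vi _] ir].
  have {}ir : i <= r by [].
  rewrite /P; apply/eqP; rewrite eqb0 negb_and negbK -implybE; apply/implyP => iU.
  have {}ir : i < r by rewrite ltn_neqAle ir andbT; apply: contra rU => /eqP <-.
  by case: NL => [[_]|[_ _ _]]; apply=> //; rewrite vi.
have pv : p < r -> p < v.
  move=> pr; have := H r; rewrite consE pr leqnn /=.
  by case: (ltnP p v) => // vp; rewrite (maxn_idPr vp) in Prv; rewrite Prv.
apply: IH => [|x xs|y|x l].
- exact: path_sorted srt.
- have [|xU xL] := sUL x; first by rewrite inE xs orbT.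
  split=> //.
  rewrite mem_setf !inE negb_or xL andbT.
  by apply: contra rs => /eqP <-.
- set Q := (fun u => _).
  have QE u : Q u = P u && (u != v).
    by rewrite /Q /P mem_codomf_set // negb_or; case: (u \in U); rewrite //= andbC.
  have := H y; rewrite consE.
  case: (ltnP p r) => pr; last first.
    rewrite /= add0n => /leq_trans; apply; apply: leq_cnt => i /andP[pi _] Pi.
    rewrite QE Pi /=; case: NL => [[-> _]|[_ vr _ _]]; first by rewrite gtn_eqF //; lia.
    by rewrite gtn_eqF //; lia.
  have {}pv := pv pr; have [vU vr vL _] : [/\ v \in U, v < r, v \notin codomf L & true].
    by case: NL => [[v1 _]|[]]; [lia|].
  have CQ : cnt Q p y + (v <= y) = cnt P p y.
    rewrite (@cnt_split P (pred1 v) p y) addnC; congr (_ + _); last exact: eq_in_cnt.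
    rewrite -[(v <= y)]/(true && (v <= y)) -pv -cnt_pred1; apply: eq_in_cnt => i _ /=.
    by case: (i =P v) => [->|]; rewrite ?andbF // /P vU vL.
  case: (ltnP y v) CQ => [yv|vy] CQ; first by lia.
  case: (leqP r y) => /= yr Hy; first by lia.
  have := H r; rewrite consE pr leqnn /=.
  rewrite (maxn_idPl (ltnW pv)) in Prv.
  have py : p <= y by lia.
  have yr' := ltnW yr.
  rewrite (@cnt_cat (mem s) p y r) ?py // (@cnt_cat P p y r) ?py //.
  move: Prv; rewrite (@cnt_cat P v y r) ?vy // => /eqP.
  rewrite addn_eq0 => /andP[_ /eqP->].
  by rewrite addn0 -CQ add1n addn1 ltnS; apply: leq_trans (leq_addr _ _).
- rewrite fnd_set; case: eqP => [-> [<-]|_] //; exact: Lp.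
Qed.

(** * Labels in a column of a diagram *)

Lemma mem_col_rows (D : cell_map) (c r : nat) :
  (r \in col_rows D c) = ((r, c) \in domf D).
Proof.
apply/imfsetP/idP => [[[r' c'] /=]|rD].
  by rewrite !inE => /andP[D1 /eqP /= <-] ->.
by exists (r, c) => //=; rewrite !inE rD /=.
Qed.

Lemma right_rowsP (D : cell_map) (c r : nat) :
  reflect (exists2 c', c < c' & (r, c') \in domf D) (r \in right_rows D c).
Proof.
apply: (iffP (imfsetP _ _ _ _)) => [[[r' c'] /=]|[c' cc' rD]].
  by rewrite !inE => /andP[D1 /= D2] ->; exists c'.
by exists (r, c') => //=; rewrite !inE rD /=.
Qed.

Section ColumnLabels.
Variables (D : cell_map) (c : nat).
Let R := col_rows D c.
Let U := right_rows D c.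
Let L0 := [fmap r : R `&` U => val r].
Let s := sort geq (R `\` U).

Lemma init_fnd r : L0.[? r] = if r \in R `&` U then Some r else None.
Proof.
case: ifP => [rRU|/negbT rRU]; first by rewrite in_fnd ffunE.
by rewrite not_fnd.
Qed.

Lemma col_labels_dom q : (q \in domf (col_labels D c)) = ((q, c) \in domf D).
Proof.
rewrite -mem_col_rows -[col_labels D c]/(add_labels U L0 s) add_labels_dom /=.
rewrite mem_sort !inE -/R -/U.
by case: (q \in R); case: (q \in U).
Qed.

Lemma free_rows_uniq : uniq s.
Proof. by rewrite sort_uniq fset_uniq. Qed.

Lemma free_rows_fresh r : r \in s -> r \notin U /\ r \notin domf L0.
Proof. by rewrite mem_sort !inE => /andP[/negPf -> _]; rewrite andbF. Qed.

(** Labels map the cells in (p, y] injectively to rows of U in (p, y]: they exceed p, hence are not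
    the default 1, and they never exceed their own row. *)
Lemma hall_of_labels p : 0 < p ->
  (forall q l, (col_labels D c).[? q] = Some l -> p < q -> p < l) ->
  hall (fun r => r \in R) (fun r => r \in U) p.
Proof.
move=> p0 H y; rewrite !cntE.
have [Lle Linj] : proper_labels U (col_labels D c).
  apply: add_labels_proper free_rows_uniq _ _ => [r /free_rows_fresh[] //|].
  split=> [r l|r r' l]; rewrite !init_fnd.
    by case: ifP => //; rewrite inE => /andP[_ rU] [<-]; right.
  by case: ifP => // _ [<-]; case: ifP => // _ [<-]; left.
pose f r := odflt 0 (col_labels D c).[? r].
have fE r : r \in R -> (col_labels D c).[? r] = Some (f r).
  move=> rR; rewrite /f; case E: (_.[? r]) => //.
  by have := fndSome (col_labels D c) r; rewrite E col_labels_dom -mem_col_rows rR.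
set X := filter _ _; set Y := filter _ _.
have XP r : r \in X -> [/\ p < r, r <= y, r \in R & p < f r].
  rewrite mem_filter mem_index_iota ltnS => /and3P[rR pr ry].
  by split=> //; apply: H pr; exact: fE.
rewrite -(size_map f); apply: uniq_leq_size => [|l /mapP[r /XP[pr ry rR pf] ->]].
  rewrite map_inj_in_uniq ?filter_uniq ?iota_uniq // => r r' /XP[_ _ rR pf] /XP[_ _ rR' _] E.
  by case: (Linj r r' (f r)); [exact: fE|rewrite E; exact: fE|by []|lia].
rewrite mem_filter mem_index_iota ltnS pf.
by case: (Lle r (f r)); [exact: fE|lia|move=> [-> /leq_trans->]].
Qed.

(** The initial identity labelling uses up the rows of R in U, which contribute equally to both
    sides of Hall's condition; cancelling them leaves the hypothesis of [add_labels_hall]. *)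
Lemma labels_of_hall p : 0 < p ->
  hall (fun r => r \in R) (fun r => r \in U) p ->
  forall q l, (col_labels D c).[? q] = Some l -> p < q -> p < l.
Proof.
move=> p0 H; apply: add_labels_hall => //.
- rewrite gtn_sorted_uniq_geq free_rows_uniq sort_sorted // => m n.
  exact: leq_total.
- exact: free_rows_fresh.
- move=> y; have := H y.
  rewrite (cnt_split _ (fun r => r \in U)).
  rewrite (@cnt_split (fun r => r \in U) (fun r => r \in R)).
  rewrite (@eq_in_cnt (fun r => (r \in U) && (r \in R)) (fun r => (r \in R) && (r \in U))) => [|i _]; last exact: andbC.
  rewrite leq_add2l.
  rewrite (@eq_in_cnt (mem s) (fun r => (r \in R) && (r \notin U))) => [|i _]; last first.
    by rewrite -topredE /= mem_sort !inE andbC.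
  move=> /leq_trans; apply; apply: leq_cnt => i _ /andP[iU iR]; rewrite iU /=.
  apply/codomfPn => x; rewrite init_fnd; case: ifP => //.
  by rewrite inE => /andP[xR _]; apply: contra iR => /eqP[<-].
- by move=> r l; rewrite init_fnd; case: ifP => // _ [<-].
Qed.

End ColumnLabels.

(** * Ghost moves as drops within a column *)

Definition ordinary (E : cell_map) (c : nat) : pred nat :=
  fun r => E.[? (r, c)] == Some false.

(** An effective ghost move described without maxima: ordinary cells filling (h, r] express both the
    maximality of h and the absence of blocking ghosts, and the last clause says that the cell is
    rightmost. *)
Definition legal (E : cell_map) (r c h : nat) : Prop :=
  [/\ 0 < h < r, forall i, h < i <= r -> ordinary E c i,
      (h, c) \notin domf E & r \notin right_rows E c].

Definition moved (E : cell_map) (r c h : nat) : cell_map :=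
  E.[(h, c) <- false].[(r, c) <- true].

Lemma ordinaryE (E : cell_map) (c r : nat) :
  ordinary E c r = ((r, c) \in domf E) && ~~ is_ghost E (r, c).
Proof.
by rewrite /ordinary /is_ghost -fndSome; case: (_.[? _]) => [[]|].
Qed.

Lemma ordinary_dom (E : cell_map) (c r : nat) : ordinary E c r -> (r, c) \in domf E.
Proof. by rewrite ordinaryE => /andP[]. Qed.

Lemma drop_row_empty (E : cell_map) (r c : nat) : drop_row E r c != 0 ->
  0 < drop_row E r c < r /\ (drop_row E r c, c) \notin domf E.
Proof.
suff : drop_row E r c = 0 \/
    0 < drop_row E r c < r /\ (drop_row E r c, c) \notin domf E.
  by case=> // ->.
rewrite {1 2 3 4}/drop_row big_seq_cond; elim/big_ind: _ => [|x y hx hy|i]; first by left.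
  by case: (leqP x y).
by rewrite mem_index_iota => /andP[iP iE]; right.
Qed.

Lemma drop_row_ge (E : cell_map) (r c i : nat) :
  0 < i < r -> (i, c) \notin domf E -> i <= drop_row E r c.
Proof.
move=> ir iE.
by apply: (@leq_bigmax_seq _ _ (fun i => (i, c) \notin domf E) id) => //; rewrite mem_index_iota.
Qed.

Lemma rightmost_ge (E : cell_map) (r c : nat) :
  (r, c) \in domf E -> c <= rightmost E r.
Proof.
move=> rE.
exact: (@leq_bigmax_seq _ (enum_fset (domf E)) (fun p => p.1 == r) snd (r, c)).
Qed.

Lemma ghost_moveP (E : cell_map) (r : nat) : ghost_move E r = E \/
  exists c h, legal E r c h /\ ghost_move E r = moved E r c h.
Proof.
rewrite /ghost_move; set c := rightmost E r; set h := drop_row E r c.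
case: ifP => [_|/negbT H]; [by left|right; exists c, h; split=> //].
move: H; rewrite !negb_or negbK -all_predC => /and4P[rE rG h0 /allP hG].
have [hr hE] := drop_row_empty h0; split=> // [i /andP[hi ir]|].
  have [->|/eqP ir'] := i =P r; first by rewrite ordinaryE rE.
  have {}ir : i < r by rewrite ltn_neqAle ir'.
  have := hG i; rewrite mem_index_iota hi ir => /(_ isT) /= iG.
  rewrite ordinaryE iG andbT; apply: contraT => iE.
  by have := @drop_row_ge E r c i; rewrite ir (leq_ltn_trans _ hi) // leqNgt hi => /(_ isT iE).
by apply/right_rowsP => -[c' cc' /rightmost_ge]; rewrite leqNgt cc'.
Qed.

Lemma ghost_move_legal (E : cell_map) (r c h : nat) :
  legal E r c h -> ghost_move E r = moved E r c h.
Proof.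
case=> hr hO hE rU.
have /ordinary_dom rE : ordinary E c r by rewrite hO // leqnn andbT; case/andP: hr.
have cE : rightmost E r = c.
  apply/eqP; rewrite eqn_leq rightmost_ge // andbT.
  apply/bigmax_leqP_seq => -[r' c'] /= p1 /eqP r'E.
  by rewrite leqNgt; apply: contra rU => cc'; apply/right_rowsP; exists c'; rewrite -?r'E.
have dE : drop_row E r c = h.
  apply/eqP; rewrite eqn_leq drop_row_ge // andbT leqNgt; apply/negP => hd.
  have [|/andP[_ dr]] := @drop_row_empty E r c; first by rewrite -lt0n (leq_ltn_trans _ hd).
  by rewrite ordinary_dom // hO // hd ltnW.
rewrite /ghost_move cE dE; case: ifP => // /or4P[/negP//|rG|h0|/hasP[i]].
- by have := hO r; rewrite ordinaryE rG andbF leqnn andbT; case/andP: hr => _ -> /(_ isT).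
- by move: hr; rewrite (eqP h0).
- rewrite mem_index_iota => /andP[hi ir] iG.
  by have := hO i; rewrite ordinaryE iG andbF hi ltnW // => /(_ isT).
Qed.

Lemma moved_fnd (E : cell_map) (r c h : nat) (p : nat * nat) :
  (moved E r c h).[? p] =
  if p == (r, c) then Some true else if p == (h, c) then Some false else E.[? p].
Proof. by rewrite !fnd_set. Qed.

Lemma moved_dom (E : cell_map) (r c h : nat) (p : nat * nat) : legal E r c h ->
  (p \in domf (moved E r c h)) = (p == (h, c)) || (p \in domf E).
Proof.
case=> /andP[_ hr] hO _ _; rewrite -!fndSome moved_fnd.
case: eqP => [->|_]; last by case: eqP.
have /ordinary_dom : ordinary E c r by rewrite hO // hr /=.
by rewrite -fndSome => ->; rewrite orbT.
Qed.

Lemma moved_ordinary (E : cell_map) (r c h i : nat) : legal E r c h ->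
  ordinary (moved E r c h) c i = drop_cell (ordinary E c) r h i.
Proof.
case=> /andP[_ hr] _ _ _; rewrite /ordinary moved_fnd /drop_cell !xpair_eqE eqxx !andbT.
by case: (i =P r) => [->|_]; [rewrite gtn_eqF|case: (i =P h)].
Qed.

Lemma moved_other (E : cell_map) (r c h : nat) (p : nat * nat) :
  p.2 != c -> (moved E r c h).[? p] = E.[? p].
Proof. by case: p => i c' /= /negPf cc; rewrite moved_fnd !xpair_eqE cc !andbF. Qed.

Lemma eq_right_rows (E F : cell_map) (c r : nat) :
  (forall p, c < p.2 -> E.[? p] = F.[? p]) ->
  (r \in right_rows E c) = (r \in right_rows F c).
Proof.
move=> EF; apply/right_rowsP/right_rowsP => -[c' cc' rE]; exists c' => //; move: rE;
by rewrite -!fndSome EF.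
Qed.

Lemma moved_right_rows (E : cell_map) (r c h i : nat) :
  (i \in right_rows (moved E r c h) c) = (i \in right_rows E c).
Proof. by apply: eq_right_rows => p cp; rewrite moved_other ?gtn_eqF. Qed.

Lemma is_ghost_moved (E : cell_map) (r c h : nat) (p : nat * nat) : legal E r c h ->
  is_ghost (moved E r c h) p = (p == (r, c)) || is_ghost E p.
Proof.
case=> _ _ hE _; rewrite /is_ghost moved_fnd; case: ifP => // _; case: (p =P (h, c)) => // ->.
by rewrite not_fnd.
Qed.

(** * Invariants of reachable diagrams *)

(** Idle ghost moves are discarded, so invariants need checking only on legal moves. *)
Lemma GKD_legal_ind (D : cell_map) (P : cell_map -> Prop) : P D ->
  (forall E r c h, GKD D E -> P E -> legal E r c h -> P (moved E r c h)) ->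
  forall E, GKD D E -> P E.
Proof.
move=> PD Pm E; elim=> // {}E r DE PE.
by have [->|[c [h [L ->]]]] := ghost_moveP E r; last exact: Pm.
Qed.

Lemma GKD_sub (D E : cell_map) : GKD D E -> {subset domf D <= domf E}.
Proof.
move: E; apply: GKD_legal_ind => // E r c h _ IH L p /IH pE.
by rewrite moved_dom // pE orbT.
Qed.

Lemma GKD_is_diagram (D E : cell_map) : is_diagram D -> GKD D E -> is_diagram E.
Proof.
move=> hD; move: E; apply: GKD_legal_ind => // E r c h _ IH L i j.
rewrite moved_dom // => /orP[/eqP[-> ->]|/IH //].
have [/andP[h0 hr] hO _ _] := L; split=> //.
by have /ordinary_dom/IH[] : ordinary E c r by rewrite hO // hr /=.
Qed.

(** Each legal move makes one new ghost and fills one empty position, destroying no ghost. *)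
Lemma GKD_num_ghosts (D E : cell_map) : ghost_free D -> GKD D E ->
  num_ghosts E + #|` domf D| = #|` domf E|.
Proof.
move=> hng; move: E; apply: GKD_legal_ind => [|E r c h _ IH L].
  rewrite /num_ghosts (_ : [fset p in domf D | is_ghost D p] = fset0) ?cardfs0 //.
  apply/fsetP => p; rewrite !inE /=; apply/negP => /andP[pD].
  exact/negP/hng.
have [/andP[h0 hr] hO hE _] := L.
have -> : domf (moved E r c h) = (h, c) |` domf E.
  by apply/fsetP => p; rewrite moved_dom // !inE.
rewrite cardfsU1 hE -IH addnA; congr (_ + _).
have /andP[rE rG] : ((r, c) \in domf E) && ~~ is_ghost E (r, c).
  by rewrite -ordinaryE hO // hr /=.
pose X (F : cell_map) := [fset p in domf F | is_ghost F p].
rewrite -[num_ghosts _]/#|`X _| -[num_ghosts E]/#|`X E|.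
have -> : X (moved E r c h) = (r, c) |` X E.
  apply/fsetP => p; rewrite /X !inE is_ghost_moved //=.
  case: (p =P (r, c)) => [->|_] //=.
  case: (p =P (h, c)) => [->|_] //=.
  by rewrite /is_ghost not_fnd //= andbF.
by rewrite cardfsU1 !inE /= (negPf rG) andbF.
Qed.

Lemma legal_drop (E : cell_map) (r c h : nat) : legal E r c h ->
  [/\ h < r, ordinary E c r & ~~ ordinary E c h].
Proof.
case=> /andP[_ hr] hO hE _; split=> //; first by rewrite hO // hr /=.
by apply: contra hE => /ordinary_dom.
Qed.

(** U is taken from D throughout. Positions are never vacated, so a cell rightmost in its row of E
    lies in a row outside U, as [hall_drop] requires. *)
Lemma GKD_hall (D E : cell_map) (c p : nat) :
  (p, c) \notin domf D -> hall (ordinary D c) (fun r => r \in right_rows D c) p ->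
  GKD D E -> (p, c) \notin domf E.
Proof.
set U := fun r => _; move=> pD HD DE.
suff [] : (p, c) \notin domf E /\ hall (ordinary E c) U p by [].
move: E DE; apply: GKD_legal_ind => // E r c' h DE [pE HE] L.
have [cc|cc] := eqVneq c c'; last first.
  split; first by rewrite -fndSome moved_other ?fndSome.
  move=> y; rewrite (@eq_in_cnt _ (ordinary E c)) // => i _.
  by rewrite /ordinary moved_other.
subst c'; have [hr rO hO] := legal_drop L; have [_ HO hE rU] := L.
have Op : ~~ ordinary E c p by apply: contra pE => /ordinary_dom.
have Ur : ~~ U r.
  apply: contra rU => /right_rowsP[c' cc' rD]; apply/right_rowsP; exists c' => //.
  exact: GKD_sub DE _ rD.
have [ph HE'] := hall_drop HE Op hO Ur hr HO.
split; first by rewrite moved_dom // negb_or pE xpair_eqE eq_sym (negPf ph).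
move=> y; rewrite (@eq_in_cnt _ (drop_cell (ordinary E c) r h)) // => i _.
exact: moved_ordinary.
Qed.

(** Filled positions stay filled, so p was empty all along and no drop crossed it; a drop above p
    only moves a cell down towards p. *)
Lemma GKD_cnt_ge (D E : cell_map) (c p y : nat) : GKD D E -> (p, c) \notin domf E ->
  cnt (ordinary D c) p y <= cnt (ordinary E c) p y.
Proof.
move: E; apply: GKD_legal_ind => // E r c' h DE IH L.
rewrite moved_dom // negb_or => /andP[ph pE]; apply: leq_trans (IH pE) _.
have [cc|cc] := eqVneq c c'; last first.
  by apply: leq_cnt => i _; rewrite /ordinary moved_other.
subst c'; have [hr rO hO] := legal_drop L; have [_ HO hE rU] := L.
rewrite (@eq_in_cnt (ordinary (moved E r c h) c) (drop_cell (ordinary E c) r h)); last first.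
  by move=> i _; exact: moved_ordinary.
apply: cnt_drop_ge => //; case: (ltnP p h) => //= hp; rewrite leqNgt.
apply: contra pE => pr; apply: ordinary_dom; apply: HO.
by rewrite ltn_neqAle hp ltnW // !andbT; apply: contra ph => /eqP->.
Qed.

Lemma snowP (D : cell_map) (p c : nat) :
  reflect [/\ 0 < p, (p, c) \notin domf D &
    exists q l, [/\ (col_labels D c).[? q] = Some l, p < q & l <= p]]
  ((p, c) \in snow D).
Proof.
rewrite /snow !inE /=; apply: (iffP and3P) => [[H pD]|[p0 pD [q [l [ql pq lp]]]]].
  move=> /hasP[[q c'] qD /= /and3P[/eqP cc pq]]; rewrite cc in qD *.
  case ql : (_.[? _]) => [l|] //= lp; split=> //; last by exists q, l.
  case/imfset2P: H => -[q' c''] _ [i iq [-> _]].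
  suff: i \in index_iota 1 q' by rewrite mem_index_iota => /andP[].
  exact: iq.
have qD : (q, c) \in domf D by rewrite -col_labels_dom -fndSome ql.
split=> //; last by apply/hasP; exists (q, c) => //=; rewrite eqxx pq ql.
apply/imfset2P; exists (q, c) => //; exists p => //.
have : p \in index_iota 1 q by rewrite mem_index_iota p0.
by [].
Qed.

(** * The strategy: settling the columns *)

Definition settled (E : cell_map) (c : nat) : Prop :=
  forall r e, ordinary E c r -> r \notin right_rows E c -> 0 < e < r ->
  (e, c) \in domf E.

(* Invariant of the strategy: no ghost blocks a cell that may still drop. *)
Definition unblocked (E : cell_map) (c : nat) : Prop :=
  forall g s e, is_ghost E (g, c) -> ordinary E c s -> s \notin right_rows E c ->
  g < s -> 0 < e < g -> (e, c) \in domf E.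

Lemma highest_move (E : cell_map) (c : nat) : unblocked E c -> ~ settled E c ->
  exists r h, legal E r c h /\ unblocked (moved E r c h) c.
Proof.
move=> J nS.
pose bad r := [&& ordinary E c r, r \notin right_rows E c
                & has (fun e => (e, c) \notin domf E) (index_iota 1 r)].
have badI r e : ordinary E c r -> r \notin right_rows E c -> 0 < e < r ->
    (e, c) \notin domf E -> bad r.
  move=> rO rU er eE; apply/and3P; split=> //.
  by apply/hasP; exists e; rewrite ?mem_index_iota.
(* [settled] is not boolean, so a bad row is found by a finite search up to the top row. *)
have ex_bad : exists r, bad r.
  case: (boolP (has bad (index_iota 0 (\max_(p <- domf E) p.1).+1))) => [/hasP[r _ br]|/hasPn nb].
    by exists r.
  case: nS => r e rO rU er; apply: contraT => eE.
  apply: contraT => _; apply: contraLR (badI _ _ rO rU er eE) => _; apply: nb.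
  rewrite mem_index_iota ltnS /=.
  exact: (@leq_bigmax_seq _ (enum_fset (domf E)) predT fst (r, c) (ordinary_dom rO)).
have bad_le r : bad r -> r <= \max_(p <- domf E) p.1.
  move=> /and3P[/ordinary_dom rE _ _].
  exact: (@leq_bigmax_seq _ (enum_fset (domf E)) predT fst (r, c) rE).
case: (ex_maxnP ex_bad bad_le) => r /and3P[rO rU /hasP[e er eE]] r_max.
rewrite mem_index_iota in er.
have d0 : drop_row E r c != 0.
  by have := drop_row_ge er eE; case/andP: er; case: (drop_row _ _ _) => //; case: e {eE}.
have [dr dE] := drop_row_empty d0; set h := drop_row E r c in d0 dr dE.
have [h0 hr] := andP dr.
have L : legal E r c h.
  split=> // i /andP[hi]; rewrite leq_eqVlt => /orP[/eqP-> //|ir].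
  rewrite ordinaryE; apply/andP; split; last first.
    (* A ghost between h and r would, by the invariant for r, force h to be filled. *)
    by apply/negP => iG; case/negP: dE; apply: (J i r); rewrite ?h0.
  apply: contraT => iE; have := @drop_row_ge E r c i.
  by rewrite ir (leq_ltn_trans _ hi) // leqNgt hi => /(_ isT iE).
exists r, h; split=> // g s f.
rewrite is_ghost_moved // moved_ordinary // moved_right_rows moved_dom // /drop_cell.
move=> gG sO sU gs /andP[f0 fg]; apply: contraT; rewrite negb_or => /andP[fh fE].
case/negP: (fE); case/orP: gG => [/eqP[gr]|gG].
  (* New ghost at r: a cell above it violating the invariant would be a bad row higher than r. *)
  rewrite gr in gs fg; case/orP: sO => [/eqP sh|/andP[_ sO]].
    by move: gs; rewrite sh ltnNge ltnW.
  have /r_max : bad s by apply: (badI s f) => //; rewrite f0 (ltn_trans fg).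
  by rewrite leqNgt gs.
(* Old ghost g: if the cell above it is the dropped one, then g < h < r and the old invariant
   applies to row r. *)
case/orP: sO => [/eqP sh|/andP[_ sO]].
  by apply: (J g r) => //; rewrite ?f0 // (leq_trans gs) // sh ltnW.
by apply: (J g s) => //; rewrite f0.
Qed.

(** Terminates because each move fills a further position of the finite [box D]. *)
Lemma settle_column (D E : cell_map) (c : nat) : GKD D E -> unblocked E c ->
  exists F, [/\ GKD D F, forall p, p.2 != c -> F.[? p] = E.[? p] & settled F c].
Proof.
have [m] := ubnP #|` box D `\` domf E|; elim: m E => // m IH E mE DE J.
case: (boolp.pselect (settled E c)) => [S|/(highest_move J) [r [h [L J']]]].
  by exists E.
have DM : GKD D (moved E r c h) by rewrite -(ghost_move_legal L); exact: GKD_move.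
have lt : #|` box D `\` domf (moved E r c h)| < #|` box D `\` domf E|.
  have [_ _ hE _] := L; have hB : (h, c) \in box D.
    by apply: (fsubsetP (GKD_domf_box DM)); rewrite moved_dom // eqxx.
  rewrite (cardfsD1 (h, c) (box D `\` domf E)) in_fsetD hE hB.
  apply/fsubset_leq_card/fsubsetP => p.
  by rewrite in_fsetD moved_dom // negb_or in_fsetD1 in_fsetD -andbA.
have [|F [DF FE S]] := IH _ _ DM J'; first exact: leq_trans lt _.
by exists F; split=> // p pc; rewrite FE // moved_other.
Qed.

(** Going from left to right, column k and all columns beyond it are still as in D when k is
    treated: k holds no ghost, so it is vacuously unblocked, and its right rows are those of D. *)
Lemma settle_columns (D : cell_map) (k : nat) : ghost_free D ->
  exists E, [/\ GKD D E, forall p, k <= p.2 -> E.[? p] = D.[? p] &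
    forall c r e, c < k -> ordinary E c r -> r \notin right_rows D c ->
      0 < e < r -> (e, c) \in domf E].
Proof.
move=> hng; elim: k => [|k [E [DE ED S]]]; first by exists D; split=> //; exact: GKD_refl.
have [|F [DF FE SF]] := settle_column DE (c := k).
  move=> g s e /eqP; rewrite ED //= => gD.
  have /hng : (g, k) \in domf D by rewrite -fndSome gD.
  by rewrite /is_ghost gD.
exists F; split=> // [p kp|c r e]; first by rewrite FE ?ED ?gtn_eqF // ltnW.
rewrite ltnS leq_eqVlt => /orP[/eqP->|ck].
  have EU i : (i \in right_rows F k) = (i \in right_rows D k).
    by apply: eq_right_rows => p kp; rewrite FE ?ED ?gtn_eqF // ltnW.
  by rewrite -EU; exact: SF.
have FEc i : F.[? (i, c)] = E.[? (i, c)] by rewrite FE //= ltn_eqF.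
rewrite /ordinary FEc => rO rU er.
by rewrite -fndSome FEc fndSome; apply: S er.
Qed.

(** * Filled positions against snowflakes *)

Lemma hall_ordinary (D : cell_map) (c p : nat) : ghost_free D ->
  hall (ordinary D c) (fun r => r \in right_rows D c) p <->
  hall (fun r => r \in col_rows D c) (fun r => r \in right_rows D c) p.
Proof.
move=> hng; have E y : cnt (ordinary D c) p y = cnt (fun r => r \in col_rows D c) p y.
  apply: eq_in_cnt => i _; rewrite ordinaryE mem_col_rows.
  by case: (boolP (_ \in _)) => //= /hng.
by split=> H y; have := H y; rewrite E.
Qed.

Lemma GKD_new_in_snow (D E : cell_map) (p c : nat) :
  is_diagram D -> ghost_free D -> GKD D E ->
  (p, c) \in domf E -> (p, c) \notin domf D -> (p, c) \in snow D.
Proof.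
move=> hD hng DE pE pD; have [p0 _] := GKD_is_diagram hD DE pE.
apply: contraTT pE => /snowP nS; apply: (GKD_hall pD _ DE).
apply/hall_ordinary => //; apply: hall_of_labels => // q l ql pq.
rewrite ltnNge; apply/negP => lp; apply: nS; split=> //.
by exists q, l.
Qed.

Lemma GKD_fill_snow (D : cell_map) : ghost_free D ->
  exists2 E, GKD D E & {subset snow D <= domf E}.
Proof.
move=> hng; pose k := (\max_(p <- domf D) p.2).+1.
have [E [DE _ S]] := settle_columns k hng; exists E => // -[p c].
move=> /snowP[p0 pD [q [l [ql pq lp]]]]; apply: contraT => pE.
have ck : c < k.
  have qD : (q, c) \in domf D by rewrite -col_labels_dom -fndSome ql.
  by rewrite ltnS; exact: (@leq_bigmax_seq _ (enum_fset (domf D)) predT snd (q, c) qD).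
have : p < l; last by rewrite ltnNge lp.
apply: (labels_of_hall p0 _ ql pq); apply/hall_ordinary => // y.
apply: leq_trans (GKD_cnt_ge y DE pE) _; apply: leq_cnt => i /andP[pi _] iO.
(* A cell of E in row i > p outside the right rows of D would, its column being settled, have no
   empty position below it, contrary to p. *)
apply: contraT => iU; case/negP: pE; apply: S iU _ => //.
by rewrite p0.
Qed.

Theorem theorem4p1 (D : cell_map) (hD : is_diagram D) (hng : ghost_free D) :
  MaxG D = sf D.
Proof.
have num E : GKD D E -> num_ghosts E = #|` domf E `\` domf D|.
  move=> DE; have /fsetIidPr ED : domf D `<=` domf E by apply/fsubsetP/GKD_sub.
  by rewrite cardfsD ED -(GKD_num_ghosts hng DE) addnK.
rewrite /MaxG; case: ex_maxnP => n /boolp.asboolP[E DE <-] n_max.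
apply/eqP; rewrite eqn_leq; apply/andP; split.
  rewrite num //; apply/fsubset_leq_card/fsubsetP => -[p c].
  by rewrite inE => /andP[pD pE]; exact: GKD_new_in_snow DE pE pD.
have [F DF SF] := GKD_fill_snow hng.
apply: leq_trans (n_max (num_ghosts F) _); last by apply/boolp.asboolP; exists F.
rewrite num //; apply/fsubset_leq_card/fsubsetP => -[p c] pS.
by rewrite inE (SF _ pS) andbT; case/snowP: pS.
Qed.
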